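(* Let $(X,\sigma,\tau)$ be a multipermutation solution of level $2$ and let $e\in X$. Then $(X,\sigma',\tau')$, where $\sigma'_x=\sigma_x\sigma_e^{-1}$ and $\tau'_y=\sigma_e\tau_{\sigma_e^{-1}(y)}$ for $x,y\in X$, is a distributive solution.
   Context: A solution is a triple $(X,\sigma,\tau)$ with $X$ a non-empty set of arbitrary cardinality and $\sigma,\tau\colon X\times X\to X$. Write $\sigma_x=\sigma(x,\cdot)$, $\tau_y=\tau(\cdot,y)$ and $r(x,y)=(\sigma_x(y),\tau_y(x))$. It is required that: (braid relation) $(\mathrm{id}\times r)(r\times \mathrm{id})(\mathrm{id}\times r)=(r\times \mathrm{id})(\mathrm{id}\times r)(r\times \mathrm{id})$ on $X^3$; (non-degenerate) all $\sigma_x$ and $\tau_y$ are bijections of $X$; (involutive) $r^2=\mathrm{id}_{X^2}$. The same notation $\sigma'_x=\sigma'(x,\cdot)$, $\tau'_y=\tau'(\cdot,y)$ is used for $(X,\sigma',\tau')$; products of maps are compositions. Retraction: define $x\sim y$ iff $\sigma_x=\sigma_y$. It is known that $\sigma,\tau$ induce well-defined operations on $X/\mathord{\sim}$, making it a solution $\mathrm{Ret}(X,\sigma,\tau)$, with $\overline\sigma([x],[y])=[\sigma(x,y)]$ and $\overline\tau([x],[y])=[\tau(x,y)]$. Put $\mathrm{Ret}^0(X,\sigma,\tau)=(X,\sigma,\tau)$ and $\mathrm{Ret}^k(X,\sigma,\tau)=\mathrm{Ret}(\mathrm{Ret}^{k-1}(X,\sigma,\tau))$ for $k\ge 1$. A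 solution is a multipermutation solution of level $m$ if $m$ is the least non-negative integer with $|\mathrm{Ret}^m(X,\sigma,\tau)|=1$. Write $x\circ y=\sigma_x(y)$ and $x\bullet y=\tau_y(x)$. A solution is distributive if $x\circ(y\circ z)=(x\circ y)\circ(x\circ z)$ and $(y\bullet z)\bullet x=(y\bullet x)\bullet(z\bullet x)$ for all $x,y,z\in X$. *)

(* Defs.v *)
From mathcomp Require Import all_boot.
From mathcomp Require Import boolp.

Set Implicit Arguments.
Unset Strict Implicit.
Unset Printing Implicit Defensive.

Local Open Scope quotient_scope.

Section Maps.
Variables (X : Type) (sigma tau : X -> X -> X).

(* [sigma x] is the map sigma_x and [tau^~ y] is the map tau_y: in particular
   tau_y(x) is [tau x y]. *)
Definition rmap (p : X * X) : X * X := (sigma p.1 p.2, tau p.1 p.2).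

Definition rmap_id (t : X * X * X) : X * X * X :=
  let: (x, y, z) := t in let: (a, b) := rmap (x, y) in (a, b, z).

Definition id_rmap (t : X * X * X) : X * X * X :=
  let: (x, y, z) := t in let: (a, b) := rmap (y, z) in (x, a, b).

Record is_solution : Prop := IsSolution {
  sol_nonempty : inhabited X;
  sol_braid :
    id_rmap \o rmap_id \o id_rmap =1 rmap_id \o id_rmap \o rmap_id;
  sol_sigma_bij : forall x, bijective (sigma x);
  sol_tau_bij : forall y, bijective (tau^~ y);
  sol_invol : involutive rmap
}.

Definition is_distributive : Prop :=
  (forall x y z, sigma x (sigma y z) = sigma (sigma x y) (sigma x z)) /\
  (forall x y z, tau (tau y z) x = tau (tau y x) (tau z x)).

End Maps.

Record solution := Solution {
  sol_carrier :> Type;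
  sigma : sol_carrier -> sol_carrier -> sol_carrier;
  tau : sol_carrier -> sol_carrier -> sol_carrier;
  solutionP : is_solution sigma tau
}.

Lemma bij_surj (A B : Type) (f : A -> B) :
  bijective f -> forall b, exists a, f a = b.
Proof. by case=> g _ gK b; exists (g b). Qed.

Lemma inj_surj_bij (A B : Type) (f : A -> B) :
  injective f -> (forall b, exists a, f a = b) -> bijective f.
Proof.
move=> fI fS; exists (fun b => projT1 (cid (fS b))) => [a|b].
  by apply: fI; case: cid.
by case: cid.
Qed.

Section Retraction.
Variable S : solution.
Implicit Types x y z u v w : S.

Definition ret_rel : rel {classic S} := fun x y => `[< @sigma S x = @sigma S y >].

Lemma ret_rel_refl : reflexive ret_rel.
Proof. by move=> x; apply/asboolP. Qed.

Lemma ret_rel_sym : symmetric ret_rel.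
Proof. by move=> x y; apply/asboolP/asboolP. Qed.

Lemma ret_rel_trans : transitive ret_rel.
Proof. by move=> y x z /asboolP xy /asboolP yz; apply/asboolP; rewrite xy. Qed.

Definition ret_equiv := EquivRel ret_rel ret_rel_refl ret_rel_sym ret_rel_trans.

Definition ret_carrier : Type := {eq_quot ret_equiv}.

Definition ret_class (x : S) : ret_carrier := \pi_{eq_quot ret_equiv} x.

Definition ret_repr (c : ret_carrier) : S := repr c.

(* The operations are computed on representatives; [ret_sigmaE] and [ret_tauE]
   show that they do not depend on the choice of the representatives. *)
Definition ret_sigma (a b : ret_carrier) : ret_carrier :=
  ret_class (sigma (ret_repr a) (ret_repr b)).

Definition ret_tau (a b : ret_carrier) : ret_carrier :=
  ret_class (tau (ret_repr a) (ret_repr b)).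

Lemma ret_reprK c : ret_class (ret_repr c) = c.
Proof. exact: reprK. Qed.

Lemma ret_classP x y : ret_class x = ret_class y <-> @sigma S x = @sigma S y.
Proof.
split=> [/(@eqmodP _ ret_equiv)/asboolP //|xy].
by apply/(@eqmodP _ ret_equiv)/asboolP.
Qed.

Lemma ret_class_surj c : exists x, ret_class x = c.
Proof. by exists (ret_repr c); rewrite ret_reprK. Qed.

Let sI x : injective (sigma x).
Proof. exact: bij_inj (sol_sigma_bij (solutionP S) x). Qed.

Let tI y : injective (@tau S ^~ y).
Proof. exact: bij_inj (sol_tau_bij (solutionP S) y). Qed.

Let sS x z : exists y, sigma x y = z.
Proof. exact: bij_surj (sol_sigma_bij (solutionP S) x) z. Qed.

Let tS y z : exists x, @tau S x y = z.
Proof. exact: bij_surj (sol_tau_bij (solutionP S) y) z. Qed.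

Let r1 x y : sigma (sigma x y) (tau x y) = x.
Proof. by case: (sol_invol (solutionP S) (x, y)). Qed.

Let r2 x y : tau (sigma x y) (tau x y) = y.
Proof. by case: (sol_invol (solutionP S) (x, y)). Qed.

Let braidS x y z : sigma x (sigma y z) = sigma (sigma x y) (sigma (tau x y) z).
Proof. by case: (sol_braid (solutionP S) (x, y, z)). Qed.

Let braidT x y z : tau (tau x y) z = tau (tau x (sigma y z)) (tau y z).
Proof. by case: (sol_braid (solutionP S) (x, y, z)). Qed.

Let fixS y z : tau y z = z -> sigma y z = y.
Proof. by move=> yz; apply: (@tI z); rewrite -{2}yz r2 yz. Qed.

Let fixT y z : sigma y z = y -> tau y z = z.
Proof. by move=> yz; apply: (@sI y); rewrite -{1}yz r1. Qed.

Let fix_tau x y z z' : sigma y z = y -> sigma (tau y x) z' = tau y x ->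
  sigma x z' = z.
Proof. by move=> yz yz'; apply: (@sI y); rewrite braidS yz' r1 yz. Qed.

Let sigma_eqP x w : @sigma S x = @sigma S w <-> @tau S ^~ x = @tau S ^~ w.
Proof.
split=> xw; apply/funext.
  move=> y; have [z yz] := sS y y.
  have [z1 h1] := sS (tau y x) (tau y x); have [z2 h2] := sS (tau y w) (tau y w).
  have e : z1 = z2.
    by apply: (@sI x); rewrite (fix_tau yz h1) xw (fix_tau yz h2).
  by apply: (@tI z1); rewrite (fixT h1) e (fixT h2).
move=> z'; have [y' /fixS h'] := tS z' z'; have [y e] := tS x y'.
have [z yz] := sS y y.
have e' : tau y w = y' by rewrite -e; have /(congr1 (@^~ y)) := xw.
rewrite (@fix_tau x y z z') // ?e // (@fix_tau w y z z') // ?e' //.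
Qed.

Let sigma_eq_r x y y' :
  @sigma S y = @sigma S y' <-> @sigma S (sigma x y) = @sigma S (sigma x y').
Proof.
split=> yy'.
  have tyy' : @tau S ^~ y = @tau S ^~ y' by apply/sigma_eqP.
  have w : tau x y' = tau x y by have /(congr1 (@^~ x)) := tyy'.
  apply/sigma_eqP/funext => u; apply: (@tI (tau x y)).
  have := braidT u (sigma x y) (tau x y); rewrite r1 r2 => ->.
  rewrite -w; have := braidT u (sigma x y') (tau x y'); rewrite r1 r2 => ->.
  by have /(congr1 (@^~ (tau u x))) := tyy'.
have w : tau x y = tau x y' by apply: (@sI (sigma x y)); rewrite r1 yy' r1.
by apply/funext => z; apply: (@sI x); rewrite (braidS x y) (braidS x y') yy' w.
Qed.

Let tau_eq_l x x' y :
  @sigma S x = @sigma S x' <-> @sigma S (tau x y) = @sigma S (tau x' y).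
Proof.
split=> xx'.
  apply/funext => z; apply: (@sI (sigma x y)).
  rewrite -braidS [in RHS]xx'.
  by rewrite -braidS xx'.
have tt : @tau S ^~ (tau x y) = @tau S ^~ (tau x' y) by apply/sigma_eqP.
have tt' u : tau u (tau x y) = tau u (tau x' y) by have /(congr1 (@^~ u)) := tt.
have p : sigma x y = sigma x' y by apply: (@tI (tau x y)); rewrite r2 tt' r2.
apply/sigma_eqP/funext => u; apply: (@tI y).
by rewrite (braidT u x) (braidT u x') p tt'.
Qed.

Let sigma_compat x x' y y' : @sigma S x = @sigma S x' ->
  @sigma S y = @sigma S y' -> @sigma S (sigma x y) = @sigma S (sigma x' y').
Proof. by move=> xx' yy'; rewrite -xx'; exact: (proj1 (sigma_eq_r x y y')). Qed.

Let tau_compat x x' y y' : @sigma S x = @sigma S x' ->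
  @sigma S y = @sigma S y' -> @sigma S (tau x y) = @sigma S (tau x' y').
Proof.
move=> xx' /sigma_eqP yy'.
have <- : tau x' y = tau x' y' by have /(congr1 (@^~ x')) := yy'.
exact: (proj1 (tau_eq_l x x' y)).
Qed.

Let ret_reprE x : @sigma S (ret_repr (ret_class x)) = @sigma S x.
Proof. by apply/ret_classP; rewrite ret_reprK. Qed.

Lemma ret_sigmaE x y :
  ret_sigma (ret_class x) (ret_class y) = ret_class (sigma x y).
Proof. by apply/ret_classP/sigma_compat; exact: ret_reprE. Qed.

Lemma ret_tauE x y :
  ret_tau (ret_class x) (ret_class y) = ret_class (tau x y).
Proof. by apply/ret_classP/tau_compat; exact: ret_reprE. Qed.

Lemma ret_is_solution : is_solution ret_sigma ret_tau.
Proof.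
split.
- by case: (sol_nonempty (solutionP S)) => x; exists; exact: ret_class x.
- move=> [[a b] c]; have [x <-] := ret_class_surj a.
  have [y <-] := ret_class_surj b; have [z <-] := ret_class_surj c.
  have := sol_braid (solutionP S) (x, y, z).
  by rewrite /= !(ret_sigmaE, ret_tauE) => -[-> -> ->].
- move=> a; have [x <-] := ret_class_surj a.
  apply: inj_surj_bij => [b c|c].
    have [y <-] := ret_class_surj b; have [z <-] := ret_class_surj c.
    rewrite !ret_sigmaE => /ret_classP h; apply/ret_classP.
    exact: (proj2 (sigma_eq_r x y z)).
  have [z <-] := ret_class_surj c; have [y xy] := sS x z.
  by exists (ret_class y); rewrite ret_sigmaE xy.
- move=> a; have [x <-] := ret_class_surj a.
  apply: inj_surj_bij => [b c|c].
    have [y <-] := ret_class_surj b; have [z <-] := ret_class_surj c.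
    rewrite !ret_tauE => /ret_classP h; apply/ret_classP.
    exact: (proj2 (tau_eq_l y z x)).
  have [z <-] := ret_class_surj c; have [y xy] := tS x z.
  by exists (ret_class y); rewrite ret_tauE xy.
move=> [a b]; have [x <-] := ret_class_surj a; have [y <-] := ret_class_surj b.
by rewrite /rmap /= !(ret_sigmaE, ret_tauE) r1 r2.
Qed.

Definition Ret : solution := Solution ret_is_solution.

End Retraction.

Definition one_element (T : Type) : Prop := exists c : T, forall x : T, x = c.

Definition multipermutation_level (S : solution) (m : nat) : Prop :=
  one_element (iter m Ret S) /\
  forall k : nat, k < m -> ~ one_element (iter k Ret S).

Lemma sigma_inv_subproof (S : solution) (x : S) :
  exists g : S -> S, cancel (sigma x) g /\ cancel g (sigma x).
Proof. by case: (sol_sigma_bij (solutionP S) x) => g; exists g. Qed.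

Definition sigma_inv (S : solution) (x : S) : S -> S :=
  projT1 (cid (sigma_inv_subproof x)).

Lemma sigmaK (S : solution) (x : S) : cancel (sigma x) (sigma_inv x).
Proof. by rewrite /sigma_inv; case: cid => g []. Qed.

Lemma sigma_invK (S : solution) (x : S) : cancel (sigma_inv x) (sigma x).
Proof. by rewrite /sigma_inv; case: cid => g []. Qed.

Definition sigma' (S : solution) (e : S) : S -> S -> S :=
  fun x => sigma x \o sigma_inv e.

(* tau'_y = sigma_e tau_{sigma_e^{-1}(y)}, with y as second argument. *)
Definition tau' (S : solution) (e : S) : S -> S -> S :=
  fun x y => sigma e (tau x (sigma_inv e y)).

(* Main.v *)
Require Import Defs.
From mathcomp Require Import all_boot.
From mathcomp Require Import boolp.

Set Implicit Arguments.
Unset Strict Implicit.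
Unset Printing Implicit Defensive.

(** If [Ret (Ret S)] is a point, all the maps sigma of [Ret S] are one and the
    same permutation alpha of the set of classes, and since [Ret S] is involutive
    all its maps tau are the inverse of alpha.  As sigma_y depends only on the
    class of [y], every index may be moved along its class.

    First, tau_y(x) is the inverse of sigma_(sigma_x(y)) at [x], so
    tau'_y(x) = sigma_e sigma_z^-1 (x) with z = sigma_x(sigma_e^-1(y)); here [z]
    is in the class of [y], so tau'_y is the inverse of sigma'_y
    ([sigma'K], [tau'K]).  In the same way sigma'_x(y) is in the class of [y]
    ([sigma'_index]).

    Secondly, the maps sigma'_x commute ([sigma'_comm]).  Write a(y) for any
    element of the class alpha[y].  The first component of the braid relation
    becomes sigma_(a(x)) sigma_y = sigma_(a(y)) sigma_x ([sigma_swap]), that is,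
    sigma_x sigma_y^-1 = sigma_(a(y))^-1 sigma_(a(x)), and these two forms give
    sigma_x sigma_e^-1 sigma_y = sigma_(a(e))^-1 sigma_(a(x)) sigma_y
    = sigma_(a(e))^-1 sigma_(a(y)) sigma_x = sigma_y sigma_e^-1 sigma_x.

    A commuting family of permutations f_x whose index is unchanged under all of
    them, paired with the inverse family, is a distributive solution
    ([commuting_solution], [commuting_distributive]): every axiom reduces to a
    commutation or a cancellation. *)

Section Commuting.
Variables (X : Type) (f t : X -> X -> X).
Hypothesis fK : forall x, cancel (f x) (t^~ x).
Hypothesis tK : forall x, cancel (t^~ x) (f x).
Hypothesis fC : forall x y z, f x (f y z) = f y (f x z).
Hypothesis f_index : forall x y, f (f x y) = f y.

Lemma index_inverse x y : f (t x y) = f x.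
Proof. by rewrite -[in RHS](tK y x) f_index. Qed.

Lemma inverse_eq x y : f x = f y -> t^~ x = t^~ y.
Proof.
by move=> xy; apply/funext => z; apply: (can_inj (fK x)); rewrite tK xy tK.
Qed.

Lemma inverse_index x y z : t z (f x y) = t z y.
Proof. by have /(congr1 (@^~ z)) := inverse_eq (f_index x y). Qed.

Lemma inverse_index_inverse x y z : t z (t x y) = t z x.
Proof. by have /(congr1 (@^~ z)) := inverse_eq (index_inverse x y). Qed.

Lemma f_inverseC x y z : f x (t z y) = t (f x z) y.
Proof. by apply: (can_inj (fK y)); rewrite tK fC tK. Qed.

Lemma inverseC x y z : t (t z x) y = t (t z y) x.
Proof. by apply: (can_inj (fK x)); rewrite tK f_inverseC tK. Qed.

Lemma commuting_solution : inhabited X -> is_solution f t.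
Proof.
move=> X0; split=> // [[[x y] z]|x|y|[x y]].
- rewrite /= !(f_index, index_inverse, inverse_index, inverse_index_inverse).
  by rewrite fC f_inverseC inverseC.
- by exists (t^~ x).
- by exists (f y).
- by rewrite /rmap /= f_index tK inverse_index_inverse fK.
Qed.

Lemma commuting_distributive : is_distributive f t.
Proof.
split=> x y z; first by rewrite f_index fC.
by rewrite inverse_index_inverse inverseC.
Qed.

End Commuting.

Section Level2.
Variables (S : solution) (e : S).
Hypothesis level2 : one_element (Ret (Ret S)).
Implicit Types x y z u v : S.

Lemma sigma_taul x y : sigma (sigma x y) (tau x y) = x.
Proof. by case: (sol_invol (solutionP S) (x, y)). Qed.

Lemma sigma_braid x y z :
  sigma x (sigma y z) = sigma (sigma x y) (sigma (tau x y) z).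
Proof. by case: (sol_braid (solutionP S) (x, y, z)). Qed.

(** This is the form in which the hypothesis on [Ret (Ret S)] is used: all maps
    sigma of [Ret S] coincide, so the left argument does not affect the class. *)
Lemma sigma_index u v y : sigma (sigma u y) = sigma (sigma v y).
Proof.
have [c allc] := level2; apply/ret_classP; rewrite -!ret_sigmaE.
have /ret_classP : @ret_class (Ret S) (ret_class u) = @ret_class (Ret S) (ret_class v).
  by rewrite [LHS](allc _) [RHS](allc _).
by move/(congr1 (@^~ (ret_class y))).
Qed.

Lemma sigma_index_inv u v y : sigma (sigma u (sigma_inv v y)) = sigma y.
Proof. by rewrite (sigma_index _ v) sigma_invK. Qed.

(** The braid relation at (sigma_u(x), y), where the class of tau_y(sigma_u(x))
    is alpha^-1(alpha[x]), that is, the class of [x]. *)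
Lemma sigma_swap u v x y z :
  sigma (sigma u x) (sigma y z) = sigma (sigma v y) (sigma x z).
Proof.
rewrite sigma_braid (sigma_index _ v); congr (sigma _ _).
set w := tau _ y.
(* Both [w] and [x] are sent by alpha to the class of sigma_u(x). *)
have aw : sigma (sigma u w) = sigma (sigma u x).
  by rewrite (sigma_index _ (sigma (sigma u x) y)) sigma_taul.
have /ret_classP := aw; rewrite -!ret_sigmaE.
have /bij_inj I := sol_sigma_bij (solutionP (Ret S)) (ret_class u).
by move=> /I /ret_classP ->.
Qed.

Lemma sigma'_comm x y z :
  sigma' e x (sigma' e y z) = sigma' e y (sigma' e x z).
Proof.
rewrite /sigma' /=; move: (sigma_inv e z) => w.
(* In the notation a(y) for an element of alpha[y], this is
   sigma_(a(e)) sigma_x sigma_e^-1 = sigma_(a(x)), with a(e) = sigma_e(e). *)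
have inv a v : sigma (sigma e e) (sigma a (sigma_inv e v)) = sigma (sigma e a) v.
  by rewrite (sigma_swap _ e) sigma_invK.
by apply: (can_inj (sigmaK (sigma e e))); rewrite !inv (sigma_swap _ e).
Qed.

Lemma sigma'_index x y : sigma' e (sigma' e x y) = sigma' e y.
Proof. by rewrite /sigma' /= sigma_index_inv. Qed.

Lemma tau'K y : cancel ((tau' e)^~ y) (sigma' e y).
Proof.
move=> x; rewrite /sigma' /tau' /= sigmaK.
by rewrite -(sigma_index_inv x e y) sigma_taul.
Qed.

Lemma sigma'K y : cancel (sigma' e y) ((tau' e)^~ y).
Proof.
have I : injective (sigma' e y).
  exact: inj_comp (can_inj (sigmaK y)) (can_inj (sigma_invK e)).
by move=> x; apply: I; rewrite tau'K.
Qed.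

End Level2.

Theorem theorem7p12 (S : solution) (e : S) :
  multipermutation_level S 2 ->
  is_solution (sigma' e) (tau' e) /\ is_distributive (sigma' e) (tau' e).
Proof.
move=> [level2 _].
have fK := sigma'K e level2; have tK := tau'K e level2.
have fC := sigma'_comm e level2; have fI := sigma'_index e level2.
split; last exact: commuting_distributive fK tK fC fI.
exact: commuting_solution fK tK fC fI (inhabits e).
Qed.
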